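(* Let $\eta\in\mathbb C\setminus\{0\}$ and let $V_{\lambda_1}(\delta_1)$, $V_{\lambda_2}(\delta_2)$ be evaluation representations modelled on arbitrary (finite- or infinite-dimensional) highest weight representations $V_{\lambda_1},V_{\lambda_2}$ of $\mathfrak{sl}_2$. Let $F_{12}$, $F_{21}^{-1}$, $Q_{12}$, $Q_{21}^{-1}$, $R_+$, $R_0$, $R_-$ be the operators on $V_{\lambda_1}(\delta_1)\otimes V_{\lambda_2}(\delta_2)$, and $\chi$ the scalar, defined in the context; their coefficients are functions of $\delta_1-\delta_2$. Then $$R_0/\chi = Q_{21}^{-1}\,Q_{12},\qquad F_{21}^{-1}=R_+\,Q_{21}^{-1},\qquad F_{12}=Q_{12}\,R_-,$$ and consequently $$F_{21}^{-1}\,F_{12}=R_+\,Q_{21}^{-1}\,Q_{12}\,R_-=R_+\,(R_0/\chi)\,R_-,$$ i.e. the twist $F_{12}$ factorizes the $R$-matrix of $Y(\mathfrak{sl}_2)$ on evaluation representations, normalized by dividing by its character $\chi$.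
   Context: $\mathfrak{sl}_2$ has basis $H,E,F$ with $[H,E]=E$, $[H,F]=-F$, $[E,F]=2H$. For $\lambda\in\mathbb C$, $V_\lambda$ is the highest weight representation with basis $|k\rangle$, $k\in K_\lambda$, where $K_\lambda=\{0,\dots,2\lambda\}$ if $2\lambda\in\mathbb N_0$ and $K_\lambda=\mathbb N_0$ otherwise, and $H|k\rangle=(\lambda-k)|k\rangle$, $E|k\rangle=k|k-1\rangle$, $F|k\rangle=(2\lambda-k)|k+1\rangle$; $|k\rangle:=0$ if $k\notin K_\lambda$. $V_\lambda(\delta)$ denotes $V_\lambda$ regarded as an evaluation representation of the Yangian with parameter $\delta\in\mathbb C$; as a vector space it is $V_\lambda$. Write $|\ell,k\rangle=|\ell\rangle\otimes|k\rangle$ for $(\ell,k)\in K_{\lambda_1}\times K_{\lambda_2}$, and $d=(\delta_1-\delta_2)/\eta$. For fixed $\lambda_1,\lambda_2$, all coefficients are read as rational (for $R_0$ and $\chi$ separately: meromorphic) functions of $\delta_1-\delta_2$, and the identities are identities of such functions. The twist is defined by $$F_{12}^{-1}=\Bigl(\sum_{n\ge0}\tfrac{(-\eta)^n}{n!}\,F^n\otimes E^n\prod_{j=1}^n\bigl(\delta_1-\delta_2+\eta(H\otimes1-1\otimes H)-\eta j\bigr)^{-1}\Bigr)Q_{12}^{-1},$$ $$F_{12}=Q_{12}\sum_{n\ge0}\tfrac{\eta^n}{n!}\Bigl(\prod_{j=1}^n\bigl(\delta_1-\delta_2+\eta(H\otimes1-1\otimes H)+\eta j\bigr)^{-1}\Bigr)F^n\otimes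 E^n$$ (on each vector only finitely many terms are nonzero), where $Q_{12}^{-1}$ is the diagonal operator $Q_{12}^{-1}|\ell,k\rangle=q_{\ell k}|\ell,k\rangle$ with $$q_{\ell k}=\prod_{j=0}^{k-1}\frac{\delta_1-\delta_2+\eta(\lambda_1-\lambda_2-\ell+j)}{\delta_1-\delta_2+\eta(-\lambda_1-\lambda_2+j)}.$$ For an operator $X_{12}$ defined by such a formula for the ordered pair of representations, $X_{21}$ denotes the operator on $V_{\lambda_1}(\delta_1)\otimes V_{\lambda_2}(\delta_2)$ obtained by forming the same expression on $V_{\lambda_2}(\delta_2)\otimes V_{\lambda_1}(\delta_1)$ (i.e. exchanging $\lambda_1\leftrightarrow\lambda_2$, $\delta_1\leftrightarrow\delta_2$) and conjugating with the flip $a\otimes b\mapsto b\otimes a$. The factors of the universal $R$-matrix $R_+R_0R_-$ of $Y(\mathfrak{sl}_2)$ on evaluation representations (known from work of Khoroshkin and Tolstoy) are $$R_+=\sum_{n\ge0}\tfrac{\eta^n}{n!}\,E^n\otimes F^n\prod_{j=1}^n\bigl(\delta_1-\delta_2+\eta(H\otimes1-1\otimes H)+\eta j\bigr)^{-1},$$ $$R_-=\sum_{n\ge0}\tfrac{\eta^n}{n!}\Bigl(\prod_{j=1}^n\bigl(\delta_1-\delta_2+\eta(H\otimes1-1\otimes H)+\eta j\bigr)^{-1}\Bigr)F^n\otimes E^n,$$ and $R_0$ is the diagonal operator with $R_0|\ell,k\rangle=\rho_{\ell k}|\ell,k\rangle$, $$\begin{aligned}\rho_{\ell k}=\;&\f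rac{\Gamma(\frac{d+\lambda_1-\lambda_2+k+1}{2})}{\Gamma(\frac{d+\lambda_1-\lambda_2+1}{2})}\cdot\frac{\Gamma(\frac{d+\lambda_1-\lambda_2+k+2}{2})}{\Gamma(\frac{d-\lambda_1+\lambda_2+1}{2})}\cdot\frac{\Gamma(\frac{d-\lambda_1-\lambda_2+k}{2})}{\Gamma(\frac{d+\lambda_1+\lambda_2+2}{2})}\cdot\frac{\Gamma(\frac{d-\lambda_1-\lambda_2+k+1}{2})}{\Gamma(\frac{d-\lambda_1-\lambda_2}{2})}\\&\times\frac{\Gamma(\frac{d+\lambda_1-\lambda_2-\ell}{2})}{\Gamma(\frac{d+\lambda_1-\lambda_2+k-\ell}{2})}\cdot\frac{\Gamma(\frac{d+\lambda_1-\lambda_2-\ell+1}{2})}{\Gamma(\frac{d+\lambda_1-\lambda_2+k-\ell+1}{2})}\cdot\frac{\Gamma(\frac{d+\lambda_1+\lambda_2-\ell+1}{2})}{\Gamma(\frac{d+\lambda_1-\lambda_2+k-\ell+1}{2})}\cdot\frac{\Gamma(\frac{d+\lambda_1+\lambda_2-\ell+2}{2})}{\Gamma(\frac{d+\lambda_1-\lambda_2+k-\ell+2}{2})},\end{aligned}$$ and the character is the scalar $$\chi=\frac{\Gamma(\frac{d+\lambda_1+\lambda_2+1}{2})}{\Gamma(\frac{d+\lambda_1-\lambda_2+1}{2})}\cdot\frac{\Gamma(\frac{d-\lambda_1-\lambda_2+1}{2})}{\Gamma(\frac{d-\lambda_1+\lambda_2+1}{2})}.$$ *)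

(* Defs.v *)
(* MathComp-Analysis, with R[i] from real-closed as the complex numbers and
   free modules from multinomials. *)
From HB Require Import structures.
From mathcomp Require Import all_boot all_order all_algebra.
From mathcomp Require Import all_classical all_reals all_analysis.
From mathcomp.real_closed Require Import complex.
From mathcomp.multinomials Require Import freeg.

Set Implicit Arguments.
Unset Strict Implicit.
Unset Printing Implicit Defensive.

Import Order.TTheory GRing.Theory Num.Theory numFieldNormedType.Exports.

Local Open Scope classical_set_scope.
Local Open Scope complex_scope.
Local Open Scope ring_scope.

(** * The complex Gamma function *)

Definition cexp (R : realType) (z : R[i]) : R[i] :=
  (expR (complex.Re z))%:C * (cos (complex.Im z) +i* sin (complex.Im z)).

(* n! n^z / (z (z+1) ... (z+n)), where n^z = exp (z ln n) *)
Definition Gamma_seq (R : realType) (z : R[i]) (n : nat) : (R[i])^o :=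
  n`!%:R * cexp (z * (ln n%:R)%:C) / \prod_(0 <= j < n.+1) (z + j%:R).

(* Euler's limit formula, valid on all of C except at the poles 0, -1, -2, ...;
   the value at a pole is irrelevant. *)
Definition Gamma (R : realType) (z : R[i]) : R[i] := limn (Gamma_seq z).

(** * The highest weight representations *)

(* {0, ..., 2 lam} if 2 lam is a natural number, all of nat otherwise *)
Definition Kset (R : realType) (lam : R[i]) : set nat :=
  [set k | forall m : nat, 2 * lam = m%:R -> (k <= m)%N].

Definition V (R : realType) (lam : R[i]) : lmodType R[i] :=
  {freeg (Kset lam) / R[i]}.

(* |k>, with the convention |k> = 0 for k outside of Kset *)
Definition ket (R : realType) (lam : R[i]) (k : nat) : V lam :=
  if insub k is Some i then << (i : Kset lam) >> else 0.

(* fglift f is the linear map sending each basis vector <<i>> to f i. *)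
Definition opH (R : realType) (lam : R[i]) : V lam -> V lam :=
  fglift (fun i : Kset lam => (lam - (val i)%:R) *: ket lam (val i)).

(* For k = 0 the truncated predecessor is harmless: the coefficient is 0. *)
Definition opE (R : realType) (lam : R[i]) : V lam -> V lam :=
  fglift (fun i : Kset lam => (val i)%:R *: ket lam (val i).-1).

Definition opF (R : realType) (lam : R[i]) : V lam -> V lam :=
  fglift (fun i : Kset lam => (2 * lam - (val i)%:R) *: ket lam (val i).+1).

(** * Tensor products *)

(* V lam1 (x) V lam2, the basis vector |l,k> being << (l, k) >> *)
Definition VV (R : realType) (lam1 lam2 : R[i]) : lmodType R[i] :=
  {freeg (Kset lam1 * Kset lam2)%type / R[i]}.

Definition ket2 (R : realType) (lam1 lam2 : R[i])
  (p : Kset lam1 * Kset lam2) : VV lam1 lam2 := << p >>.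

Definition tensv (R : realType) (lam1 lam2 : R[i]) (v : V lam1) (w : V lam2) :
  VV lam1 lam2 :=
  fglift (fun i : Kset lam1 =>
    fglift (fun j : Kset lam2 => ket2 (i, j)) w) v.

Definition tensop (R : realType) (lam1 lam2 : R[i])
  (A : V lam1 -> V lam1) (B : V lam2 -> V lam2) : VV lam1 lam2 -> VV lam1 lam2 :=
  fglift (fun p : Kset lam1 * Kset lam2 =>
    tensv (A << p.1 >>) (B << p.2 >>)).

Definition flip (R : realType) (lam1 lam2 : R[i]) : VV lam1 lam2 -> VV lam2 lam1 :=
  fglift (fun p : Kset lam1 * Kset lam2 => ket2 (p.2, p.1)).

(** * Operators on the tensor product *)

Definition diagop (R : realType) (lam1 lam2 : R[i]) (g : nat -> nat -> R[i]) :
  VV lam1 lam2 -> VV lam1 lam2 :=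
  fglift (fun p : Kset lam1 * Kset lam2 => g (val p.1) (val p.2) *: ket2 p).

(* Inverse of an operator that is diagonal in the basis |l,k> (if none of its
   eigenvalues vanishes). *)
Definition diaginv (R : realType) (lam1 lam2 : R[i])
  (A : VV lam1 lam2 -> VV lam1 lam2) : VV lam1 lam2 -> VV lam1 lam2 :=
  fglift (fun p : Kset lam1 * Kset lam2 =>
    (coeff p (A (ket2 p)))^-1 *: ket2 p).

(* sum_(n >= 0) T n, where on each basis vector only finitely many terms are
   nonzero *)
Definition opsum (R : realType) (lam1 lam2 : R[i])
  (T : nat -> VV lam1 lam2 -> VV lam1 lam2) : VV lam1 lam2 -> VV lam1 lam2 :=
  fglift (fun p : Kset lam1 * Kset lam2 =>
    \sum_(n \in [set: nat]) T n (ket2 p)).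

(* del1 - del2 + eta (H (x) 1 - 1 (x) H) + c *)
Definition shiftH (R : realType) (eta lam1 lam2 del1 del2 c : R[i])
  (v : VV lam1 lam2) : VV lam1 lam2 :=
  (del1 - del2) *: v
  + eta *: (tensop (@opH R lam1) idfun v - tensop idfun (@opH R lam2) v)
  + c *: v.

(* prod_(1 <= j <= n) (del1 - del2 + eta (H (x) 1 - 1 (x) H) + s j)^-1,
   used with s = eta and s = - eta *)
Definition invprod (R : realType) (eta lam1 lam2 del1 del2 s : R[i]) (n : nat) :
  VV lam1 lam2 -> VV lam1 lam2 :=
  \big[(fun f g => f \o g)/idfun]_(1 <= j < n.+1)
    diaginv (@shiftH R eta lam1 lam2 del1 del2 (s * j%:R)).

(* X_21, for X given by a formula in (lam1, lam2, del1, del2) *)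
Definition swap21 (R : realType)
  (X : forall lam1 lam2 del1 del2 : R[i], VV lam1 lam2 -> VV lam1 lam2)
  (lam1 lam2 del1 del2 : R[i]) : VV lam1 lam2 -> VV lam1 lam2 :=
  @flip R lam2 lam1 \o X lam2 lam1 del2 del1 \o @flip R lam1 lam2.

(** * The twist *)

Definition qcoef (R : realType) (eta lam1 lam2 del1 del2 : R[i]) (l k : nat) :
  R[i] :=
  \prod_(0 <= j < k)
    ((del1 - del2 + eta * (lam1 - lam2 - l%:R + j%:R))
     / (del1 - del2 + eta * (- lam1 - lam2 + j%:R))).

Definition Qinv (R : realType) (eta lam1 lam2 del1 del2 : R[i]) :
  VV lam1 lam2 -> VV lam1 lam2 :=
  diagop (qcoef eta lam1 lam2 del1 del2).

Definition Q (R : realType) (eta lam1 lam2 del1 del2 : R[i]) :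
  VV lam1 lam2 -> VV lam1 lam2 :=
  diaginv (@Qinv R eta lam1 lam2 del1 del2).

Definition Finv (R : realType) (eta lam1 lam2 del1 del2 : R[i]) :
  VV lam1 lam2 -> VV lam1 lam2 :=
  opsum (fun n v => ((- eta) ^+ n / n`!%:R) *:
    tensop (iter n (@opF R lam1)) (iter n (@opE R lam2))
      (invprod eta del1 del2 (- eta) n v))
  \o @Qinv R eta lam1 lam2 del1 del2.

Definition F (R : realType) (eta lam1 lam2 del1 del2 : R[i]) :
  VV lam1 lam2 -> VV lam1 lam2 :=
  @Q R eta lam1 lam2 del1 del2
  \o opsum (fun n v => (eta ^+ n / n`!%:R) *:
       invprod eta del1 del2 eta n
         (tensop (iter n (@opF R lam1)) (iter n (@opE R lam2)) v)).

Definition Qinv21 (R : realType) (eta : R[i]) := swap21 (@Qinv R eta).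

Definition Finv21 (R : realType) (eta : R[i]) := swap21 (@Finv R eta).

(** * The factors of the R-matrix *)

Definition Rplus (R : realType) (eta lam1 lam2 del1 del2 : R[i]) :
  VV lam1 lam2 -> VV lam1 lam2 :=
  opsum (fun n v => (eta ^+ n / n`!%:R) *:
    tensop (iter n (@opE R lam1)) (iter n (@opF R lam2))
      (invprod eta del1 del2 eta n v)).

Definition Rminus (R : realType) (eta lam1 lam2 del1 del2 : R[i]) :
  VV lam1 lam2 -> VV lam1 lam2 :=
  opsum (fun n v => (eta ^+ n / n`!%:R) *:
    invprod eta del1 del2 eta n
      (tensop (iter n (@opF R lam1)) (iter n (@opE R lam2)) v)).

Definition rho (R : realType) (eta lam1 lam2 del1 del2 : R[i]) (l k : nat) :
  R[i] :=
  let d := (del1 - del2) / eta in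
  let G := fun x : R[i] => Gamma (x / 2) in
  let l := l%:R in
  let k := k%:R in
    G (d + lam1 - lam2 + k + 1) / G (d + lam1 - lam2 + 1)
  * (G (d + lam1 - lam2 + k + 2) / G (d - lam1 + lam2 + 1))
  * (G (d - lam1 - lam2 + k) / G (d + lam1 + lam2 + 2))
  * (G (d - lam1 - lam2 + k + 1) / G (d - lam1 - lam2))
  * (G (d + lam1 - lam2 - l) / G (d + lam1 - lam2 + k - l))
  * (G (d + lam1 - lam2 - l + 1) / G (d + lam1 - lam2 + k - l + 1))
  * (G (d + lam1 + lam2 - l + 1) / G (d + lam1 - lam2 + k - l + 1))
  * (G (d + lam1 + lam2 - l + 2) / G (d + lam1 - lam2 + k - l + 2)).

Definition R0 (R : realType) (eta lam1 lam2 del1 del2 : R[i]) :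
  VV lam1 lam2 -> VV lam1 lam2 :=
  diagop (rho eta lam1 lam2 del1 del2).

Definition chi (R : realType) (eta lam1 lam2 del1 del2 : R[i]) : R[i] :=
  let d := (del1 - del2) / eta in
  let G := fun x : R[i] => Gamma (x / 2) in
    G (d + lam1 + lam2 + 1) / G (d + lam1 - lam2 + 1)
  * (G (d - lam1 - lam2 + 1) / G (d - lam1 + lam2 + 1)).

Definition R0_chi (R : realType) (eta lam1 lam2 del1 del2 : R[i])
  (v : VV lam1 lam2) : VV lam1 lam2 :=
  (chi eta lam1 lam2 del1 del2)^-1 *: R0 eta del1 del2 v.

(** * Identities of meromorphic functions of del1 - del2 *)

Definition locally_finite (R : realType) (S : set R[i]) : Prop :=
  forall r : R, finite_set (S `&` [set z | `|z| <= r%:C]).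

(* Coefficients are evaluated pointwise in (del1, del2), with x / 0 = 0.  Two
   meromorphic (in particular, rational) functions on C are equal iff their
   values agree outside of a closed discrete, i.e. locally finite, subset, which
   may be taken to contain all poles of all functions occurring in them. *)
Definition mero_eq (R : realType) (f g : R[i] -> R[i] -> R[i]) : Prop :=
  exists2 S : set R[i], locally_finite S &
    forall del1 del2 : R[i], ~ S (del1 - del2) -> f del1 del2 = g del1 del2.

(* Equality of all matrix coefficients; all operators above are linear,
   hence determined by these. *)
Definition op_eq (R : realType) (lam1 lam2 : R[i])
  (A B : R[i] -> R[i] -> VV lam1 lam2 -> VV lam1 lam2) : Prop :=
  forall p q : Kset lam1 * Kset lam2,
    mero_eq (fun del1 del2 => coeff q (A del1 del2 (ket2 p)))
            (fun del1 del2 => coeff q (B del1 del2 (ket2 p))).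

(* Main.v *)
Require Import Defs.
From HB Require Import structures.
From mathcomp Require Import all_boot all_order all_algebra.
From mathcomp Require Import all_classical all_reals all_analysis.
From mathcomp.real_closed Require Import complex.
From mathcomp.multinomials Require Import freeg.
From mathcomp Require Import ring lra.

(** Exchanging the two factors turns del1 - del2 + eta (H (x) 1 - 1 (x) H) - eta j
    into the negative of the corresponding factor of R_+, and the resulting sign
    (-1)^n cancels the one in (-eta)^n.  Hence F_21^-1 = R_+ Q_21^-1 holds term by
    term, even at the poles since x / 0 = 0; F_12 = Q_12 R_- is the definition of
    F_12.

    What remains is R_0 / chi = Q_21^-1 Q_12, an identity between eigenvalues.
    After division by chi the Gamma factors pair up into
    Gamma (x / 2) Gamma ((x + 1) / 2), which is multiplied by x / 2 under
    x |-> x + 1.  So only the functional equation and the nonvanishing of Gamma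
    are needed, for d outside of +-lam1 +-lam2 + Z.  They follow from Euler's
    limit formula: the ratio of consecutive terms is 1 + O(1 / n^2), so that both
    the sequence and its inverse converge. *)

Set Implicit Arguments.
Unset Strict Implicit.
Unset Printing Implicit Defensive.

Import Order.TTheory GRing.Theory Num.Theory numFieldNormedType.Exports.
Import Normc.

Local Open Scope classical_set_scope.
Local Open Scope complex_scope.
Local Open Scope ring_scope.

(** * Euler's limit *)

(* Stated over an abstract field: applied directly to the concrete (R[i])^o, the
   underlying lemmas take minutes to unify. *)
Section FieldLimits.
Context (K : numFieldType).
Implicit Types (a b : nat -> K) (l m : K).

Definition tends_to a l := (a : nat -> K^o) @ \oo --> (l : K^o).

Lemma tends_toP a l :
  tends_to a l <-> forall e, 0 < e -> \forall n \near \oo, `|l - a n| <= e.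
Proof. exact: cvgrPdist_le. Qed.

Lemma tends_to_lim a l : tends_to a l -> limn (a : nat -> K^o) = l.
Proof. exact: (cvg_lim (@norm_hausdorff _ _)). Qed.

Lemma tends_to_cst l : tends_to (fun=> l) l.
Proof. exact: cvg_cst. Qed.

Lemma tends_toB a b l m :
  tends_to a l -> tends_to b m -> tends_to (fun n => a n - b n) (l - m).
Proof. exact: cvgB. Qed.

Lemma tends_toM a b l m :
  tends_to a l -> tends_to b m -> tends_to (fun n => a n * b n) (l * m).
Proof. exact: cvgM. Qed.

Lemma near_eq_tends_to a b l :
  (\forall n \near \oo, a n = b n) -> tends_to a l -> tends_to b l.
Proof. by move=> ab; apply: cvg_trans; apply: near_eq_cvg. Qed.

End FieldLimits.

(** * The real-valued modulus of a complex number and componentwise convergence *)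

Section ComplexNorm.
Context (R : realType).
Implicit Types z : R[i].

(** The norm of [R[i]] takes its values in [R[i]]; estimates are carried out with the real number
    [normc z], where [lra] and the order of [R] apply. *)
Lemma normr_normc z : `|z| = (normc z)%:C.
Proof. by []. Qed.

Lemma normc_ge0 z : 0 <= normc z.
Proof. by rewrite -lecR -normr_normc normr_ge0. Qed.

Lemma normcD z1 z2 : normc (z1 + z2) <= normc z1 + normc z2.
Proof. exact: le_normcD. Qed.

Lemma normcN1 z : normc (- z) = normc z.
Proof. exact: normcN. Qed.

Lemma normc_real (x : R) : normc x%:C = `|x|.
Proof. by rewrite /= expr0n addr0 sqrtr_sqr. Qed.

Lemma normc_nat n : normc (n%:R : R[i]) = n%:R.
Proof.
by rewrite -[n%:R](rmorph_nat (real_complex R)) normc_real normr_nat.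
Qed.

Lemma normc_gt0 z : z != 0 -> 0 < normc z.
Proof.
move=> z0; rewrite lt_def normc_ge0 andbT.
by apply: contra_neq z0; exact: eq0_normc.
Qed.

Lemma normc_leD z : normc z <= `|complex.Re z| + `|complex.Im z|.
Proof.
rewrite -(@ler_pXn2r _ 2) ?nnegrE ?normc_ge0 ?addr_ge0 //.
case: z => a b /=; rewrite sqr_sqrtr ?addr_ge0 ?sqr_ge0 //.
by rewrite sqrrD !real_normK ?num_real // lerD2r lerDl mulrn_wge0 ?mulr_ge0.
Qed.

Lemma normc_geRe z : `|complex.Re z| <= normc z.
Proof. by rewrite -lecR; exact: normc_ge_Re. Qed.

Lemma normc_geIm z : `|complex.Im z| <= normc z.
Proof.
rewrite -(@ler_pXn2r _ 2) ?nnegrE ?normc_ge0 //.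
case: z => a b /=; rewrite sqr_sqrtr ?addr_ge0 ?sqr_ge0 //.
by rewrite real_normK ?num_real // lerDr sqr_ge0.
Qed.

Lemma sqr_normcE z : normc z ^+ 2 = complex.Re z ^+ 2 + complex.Im z ^+ 2.
Proof. by case: z => a b /=; rewrite sqr_sqrtr ?addr_ge0 ?sqr_ge0. Qed.

Lemma cvgn_complex (a : nat -> R[i]) :
  cvgn (fun n => complex.Re (a n) : R) ->
  cvgn (fun n => complex.Im (a n) : R) ->
  exists l : R[i], tends_to a l.
Proof.
move=> /cvg_ex[/= x ax] /cvg_ex[/= y ay]; exists (x +i* y).
apply/tends_toP => e e0.
have eE : e = (complex.Re e)%:C by rewrite RRe_real // gtr0_real.
have e2 : 0 < complex.Re e / 2 by rewrite divr_gt0 // -ltcR -eE.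
move/cvgrPdist_le : ax => /(_ _ e2) ax; move/cvgrPdist_le : ay => /(_ _ e2) ay.
near=> n; rewrite eE normr_normc lecR.
apply: le_trans (normc_leD _) _; rewrite [leRHS]splitr.
rewrite [complex.Re _](raddfB (@complex.Re R : {additive Rcomplex R -> R})) /=.
rewrite [complex.Im _](raddfB (@complex.Im R : {additive Rcomplex R -> R})) /=.
apply: lerD; [near: n; exact: ax|near: n; exact: ay].
Unshelve. all: by end_near. Qed.

End ComplexNorm.

(** * Sequences whose consecutive ratios are 1 + O(1/n^2) *)

Definition summable_ratio (R : realType) (a : nat -> R[i]) (C : R) (N : nat) :=
  forall n, (N <= n)%N ->
    normc (a n.+1 - a n) <= normc (a n) * (C / (n.+1%:R * n.+2%:R)).

Section SummableRatio.
Context (R : realType) (a : nat -> R[i]).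

(** This is why [summable_ratio] uses the weight 1/((n+1)(n+2)) rather than 1/n^2: its tail sums are
    explicit. *)
Lemma telescope_inv (C : R) n :
  C / (n.+1%:R * n.+2%:R) = C / n.+1%:R - C / n.+2%:R.
Proof.
by field; rewrite -(natrD _ 2) -(natrD _ 1) !pnatr_eq0.
Qed.

(** First the sequence is bounded, by comparison with an exponential of the tail sum. Its increments
    are then at most K/((n+1)(n+2)), so adding the tail K/(n+1) to the real or imaginary part gives
    a bounded monotone real sequence. *)
Lemma ratio_cvg C N : 0 <= C -> summable_ratio a C N ->
  exists l : R[i], tends_to a l.
Proof.
move=> C0 aC.
(* One step multiplies the modulus by at most 1 + C/((n+1)(n+2)), which is at most exp (C/(n+1) -
   C/(n+2)); hence [b] is nonincreasing from [N] on. *)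
pose b n := normc (a n) * expR (C / n.+1%:R).
have b_step n : (N <= n)%N -> b n.+1 <= b n.
  move=> Nn; rewrite /b.
  have -> : C / n.+1%:R = C / (n.+1%:R * n.+2%:R) + C / n.+2%:R.
    by rewrite telescope_inv subrK.
  rewrite expRD mulrA ler_wpM2r ?expR_ge0 //.
  rewrite -[a n.+1](subrK (a n)); apply: le_trans (normcD _ _) _.
  apply: le_trans (lerD (aC _ Nn) (lexx _)) _.
  rewrite -[X in _ + X]mulr1 -mulrDr.
  by rewrite ler_wpM2l ?normc_ge0 // addrC expR_ge1Dx.
have aM n : (N <= n)%N -> normc (a n) <= b N.
  move=> Nn; apply: (@le_trans _ _ (b n)).
    by rewrite /b ler_peMr ?normc_ge0 // -expR0 ler_expR divr_ge0.
  elim: n Nn => [|n IHn]; first by rewrite leqn0 => /eqP ->.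
  rewrite leq_eqVlt => /predU1P[<- //|Nn].
  by apply: le_trans (b_step _ Nn) (IHn Nn).
pose K := b N * C.
(* [f] stands for the real or the imaginary part. *)
have cvgP (f : R[i] -> R) : (forall z, `|f z| <= normc z) ->
    (forall z1 z2, f (z1 - z2) = f z1 - f z2) -> cvgn (fun n => f (a n) : R).
  move=> f_le fB; pose u n := f (a n) + K / n.+1%:R.
  have u_step n : (N <= n)%N -> u n.+1 <= u n.
    move=> Nn; suff : f (a n.+1) - f (a n) <= K / n.+1%:R - K / n.+2%:R.
      by rewrite /u lerBlDr addrAC [_ + f _]addrC lerBrDr.
    rewrite -telescope_inv -fB; apply: le_trans (ler_norm _) _.
    apply: le_trans (f_le _) _; apply: le_trans (aC _ Nn) _.
    rewrite /K -mulrA ler_wpM2r //; last exact: aM.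
    by rewrite divr_ge0 // mulr_ge0.
  have ucvg : cvgn (u : nat -> R).
    apply: (@near_nonincreasing_is_cvgn _ _ (- b N)).
      exists N => // n /= Nn m nm; elim: m nm => [|m IHm].
        by rewrite leqn0 => /eqP ->.
      rewrite leq_eqVlt => /predU1P[<- //|nm].
      by apply: le_trans (IHm nm); apply: u_step; exact: leq_trans Nn _.
    exists N => // n /= Nn; rewrite /u -[leLHS]addr0 lerD //.
      rewrite lerNl; apply: le_trans (aM _ Nn); apply: le_trans (f_le _).
      by rewrite -normrN ler_norm.
    rewrite divr_ge0 // mulr_ge0 //; apply: le_trans (aM _ (leqnn _)).
    exact: normc_ge0.
  have -> : (fun n => f (a n)) = (u \- (fun n => K * harmonic n)).
    by apply/funext => n; rewrite /u /= addrK.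
  apply: is_cvgB => //; apply: is_cvgM; first exact: is_cvg_cst.
  by apply: cvgP; exact: cvg_harmonic.
apply: cvgn_complex; apply: cvgP.
- exact: normc_geRe.
- by move=> [? ?] [? ?].
- exact: normc_geIm.
- by move=> [? ?] [? ?].
Qed.

(** The difference of inverses is -(a_(n+1) - a_n) / (a_n a_(n+1)). Once the relative increment t is
    at most 1/2, |a_n| <= |a_(n+1)| + |a_n|/2, so |a_n| <= 2 |a_(n+1)|; this doubles the
    constant. *)
Lemma summable_ratioV C N :
  0 <= C -> (forall n, a n != 0) -> summable_ratio a C N ->
  exists N', summable_ratio (fun n => (a n)^-1) (2 * C) N'.
Proof.
(* The second bound makes 2C <= n + 1, which forces t <= 1/2. *)
move=> C0 a0 aC; exists (maxn N (Num.bound (2 * C))) => n.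
rewrite geq_max => /andP[Nn Cn].
have an := normc_gt0 (a0 n); have an1 := normc_gt0 (a0 n.+1).
set t := C / (n.+1%:R * n.+2%:R).
have t0 : 0 <= t by rewrite divr_ge0 // mulr_ge0.
have t12 : t <= 1 / 2.
  have Cn1 : 2 * C <= n.+1%:R.
    apply/ltW/(@lt_le_trans _ _ (Num.bound (2 * C))%:R).
      by apply: archi_boundP; rewrite mulr_ge0.
    by rewrite ler_nat (leq_trans Cn).
  rewrite ler_pdivrMr ?mulr_gt0 // mulrAC mul1r ler_pdivlMr // mulrC.
  by apply: le_trans Cn1 _; rewrite ler_peMr // ler1n.
have -> : (a n.+1)^-1 - (a n)^-1 = - (a n.+1 - a n) * ((a n)^-1 * (a n.+1)^-1).
  by field; rewrite a0 a0.
rewrite normcM normcN1 !normcM !normcV mulrCA ler_pM2l ?invr_gt0 //.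
rewrite ler_pdivrMr // -mulrA -/t.
have dat := aC _ Nn; rewrite -/t in dat.
apply: le_trans dat _.
have := normcD (- (a n.+1 - a n)) (a n.+1); rewrite normcN1 opprB subrK.
have := aC _ Nn; rewrite -/t.
move: t0 t12; have -> : 2 * C * ((n.+1%:R * n.+2%:R)^-1 * normc (a n.+1))
  = normc (a n.+1) * 2 * t by rewrite mulrA [LHS]mulrC -!mulrA.
move: t (normc (a n.+1 - a n)) (normc (a n)) (normc (a n.+1)) an {an1}.
move=> t d x y x0 t0 t12 dxt xdy.
rewrite ler_wpM2r //.
have : x * t <= x * (1 / 2) by rewrite ler_wpM2l // ltW.
lra.
Qed.

End SummableRatio.

(** The inverses converge as well, and the product of the two limits is 1. *)
Lemma ratio_cvg_neq0 (R : realType) (a : nat -> R[i]) C N :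
  0 <= C -> (forall n, a n != 0) -> summable_ratio a C N ->
  exists2 l : R[i], l != 0 & tends_to a l.
Proof.
move=> C0 a0 aC; have [l al] := ratio_cvg C0 aC.
have [N' /ratio_cvg[|m am]] := summable_ratioV C0 a0 aC; first exact: mulr_ge0.
exists l => //; apply/eqP => l0.
have := @tends_to_cst R[i] 1.
have -> : (fun=> 1) = (fun n => a n * (a n)^-1).
  by apply/funext => n; rewrite divff.
move=> /tends_to_lim; rewrite (tends_to_lim (tends_toM al am)).
by rewrite l0 mul0r => /eqP; rewrite eq_sym oner_eq0.
Qed.

(** * The complex exponential and its second-order estimate at 0 *)

Section Cexp.
Context (R : realType).
Implicit Types (x y : R) (u v : R[i]).

Lemma cexpD u v : cexp (u + v) = cexp u * cexp v.
Proof.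
case: u v => [x y] [x' y']; rewrite /cexp /= expRD cosD sinD.
by apply/eqP; rewrite eq_complex /=; apply/andP; split; apply/eqP; ring.
Qed.

Lemma cexp0 : cexp 0 = 1 :> R[i].
Proof. by rewrite /cexp /= expR0 cos0 sin0 mul1r. Qed.

Lemma cexp_neq0 u : cexp u != 0.
Proof.
apply: contra_neq (oner_neq0 R[i]) => u0.
by rewrite -cexp0 -{1}(subrr u) cexpD u0 mul0r.
Qed.

Lemma cexp_ln (n : nat) : (0 < n)%N -> cexp (ln n%:R)%:C = n%:R :> R[i].
Proof.
by move=> n0; rewrite /cexp /= lnK ?posrE ?ltr0n // cos0 sin0 mulr1 rmorph_nat.
Qed.

(** Mean value theorem on [0, y]; it turns bounds on the cosine into bounds on the sine. *)
Lemma sin_eq_cos_mul y : 0 <= y -> exists2 c, 0 <= c <= y & sin y = cos c * y.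
Proof.
move=> y0.
have [|c] := @MVT_segment R (@sin R) cos 0 y y0 (fun x _ => is_derive_sin x).
  exact/continuous_subspaceT/continuous_sin.
by rewrite in_itv /= sin0 !subr0 => cy ->; exists c.
Qed.

Lemma sqr_sin_le y : sin y ^+ 2 <= y ^+ 2.
Proof.
wlog y0 : y / 0 <= y.
  move=> H; have [/H //|y0] := leP 0 y.
  by rewrite -sqrrN -sinN -[leRHS]sqrrN H // oppr_ge0 ltW.
have [c _ ->] := sin_eq_cos_mul y0.
by rewrite exprMn ler_piMl ?sqr_ge0 // -(cos2Dsin2 c) lerDl sqr_ge0.
Qed.

(** Half-angle formula cos y = 1 - 2 sin^2 (y/2), with sin^2 (y/2) <= (y/2)^2. *)
Lemma cos_ge1B y : 1 - y ^+ 2 / 2 <= cos y.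
Proof.
have -> : cos y = 1 - sin (y / 2) ^+ 2 *+ 2.
  rewrite [in LHS](_ : y = (y / 2) *+ 2); last first.
    by rewrite -mulr_natr divfK ?pnatr_eq0.
  by rewrite cos_mulr2n cos2sin2; ring.
have := sqr_sin_le (y / 2); rewrite exprMn; lra.
Qed.

Lemma sin_sub_le y : `|sin y - y| <= `|y| ^+ 3 / 2.
Proof.
wlog y0 : y / 0 <= y.
  move=> H; have [/H //|y0] := leP 0 y.
  by rewrite -normrN opprD -sinN -[`|y|]normrN H // oppr_ge0 ltW.
have [c /andP[c0 cy] ->] := sin_eq_cos_mul y0.
rewrite -[X in _ - X]mul1r -mulrBl normrM (ger0_norm y0) -normrN opprB.
have := cos_ge1B c; have := cos_le1 c => c1 c2.
rewrite ger0_norm ?subr_ge0 // exprSr mulrAC ler_wpM2r //.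
have : c ^+ 2 <= y ^+ 2 by rewrite ler_pXn2r ?nnegrE.
lra.
Qed.

(** From exp (-x) >= 1 - x one gets exp x (1 - x) <= 1, so (exp x - 1 - x)(1 - x) <= x^2, and 1 - x
    >= 1/2. *)
Lemma expR_sub_le x : x <= 1 / 2 -> 0 <= expR x - 1 - x <= 2 * x ^+ 2.
Proof.
move=> x2; apply/andP; split; first by have := expR_ge1Dx x; lra.
have := expR_ge1Dx (- x); have := expRxMexpNx_1 x; have := expR_gt0 x.
move: (expR x) (expR (- x)) => e e' e0 ee' e'x.
have : e * (1 - x) <= 1 by rewrite -[leRHS]ee' ler_pM2l.
have x1 : 0 < 1 - x by lra.
move=> ex; rewrite -(ler_pM2r x1).
apply: le_trans (_ : 1 - (1 + x) * (1 - x) <= _).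
  by rewrite -addrA -opprD mulrBl lerD2r.
have : 0 <= x ^+ 2 * (1 - 2 * x) by rewrite mulr_ge0 ?sqr_ge0 //; lra.
lra.
Qed.

Lemma cexp_sub_le u :
  normc u <= 1 / 2 -> normc (cexp u - 1 - u) <= 4 * normc u ^+ 2.
Proof.
move=> u2; move: (le_trans (normc_geRe u) u2) (le_trans (normc_geIm u) u2).
rewrite sqr_normcE => x2 y2; apply: le_trans (normc_leD _) _; move: x2 y2.
case: u u2 => x y _ /=; rewrite !mul0r !subr0 !addr0 => x2 y2.
have x2' : x <= 1 / 2 by apply: le_trans x2; exact: ler_norm.
have /andP[] := expR_sub_le x2'.
have := sin_sub_le y; have := cos_ge1B y; have := cos_le1 y.
move=> cy1 cy2 sy ex0 ex2.
have E0 := expR_ge0 x.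
move: (expR x) (cos y) (sin y) E0 cy1 cy2 sy ex0 ex2 => E c s E0 c1 c2 sy E1 E2.
have xx : x ^+ 2 <= `|x| * (1 / 2).
  by rewrite -real_normK ?num_real // expr2 ler_wpM2l.
have yy : `|y| ^+ 3 <= y ^+ 2 * (1 / 2).
  by rewrite exprSr real_normK ?num_real // ler_wpM2l ?sqr_ge0.
have xy : 2 * (`|x| * `|y|) <= x ^+ 2 + y ^+ 2.
  rewrite -(real_normK (num_real x)) -(real_normK (num_real y)) -subr_ge0.
  by have := sqr_ge0 (`|x| - `|y|); rewrite sqrrB; lra.
have Ele : E <= 2 by have := ler_norm x; lra.
(* With u = x + iy, the two components are bounded by 2x^2 + y^2 and x^2 + 3y^2/2, whose sum is
   below 4|u|^2. *)
have re_le : `|E * c - 1 - x| <= 2 * x ^+ 2 + y ^+ 2.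
  have -> : E * c - 1 - x = (E - 1 - x) - E * (1 - c) by ring.
  apply: le_trans (ler_normB _ _) _; rewrite ger0_norm //.
  rewrite lerD // normrM !ger0_norm ?subr_ge0 //.
  have := ler_pM E0 _ Ele (_ : 1 - c <= y ^+ 2 / 2).
  by rewrite subr_ge0 => /(_ c1); lra.
have im_le : `|E * s - y| <= y ^+ 2 / 2 + (x ^+ 2 + y ^+ 2).
  have -> : E * s - y = E * (s - y) + (E - 1) * y by ring.
  apply: le_trans (ler_normD _ _) _; rewrite !normrM (ger0_norm E0) lerD //.
    by have := ler_pM E0 (normr_ge0 _) Ele sy; lra.
  (* Here |exp x - 1| <= |x| + 2x^2 <= 2|x|, and 2|x||y| <= x^2 + y^2. *)
  apply: le_trans xy; rewrite mulrA ler_wpM2r //.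
  rewrite (_ : E - 1 = (E - 1 - x) + x); last by ring.
  by apply: le_trans (ler_normD _ _) _; rewrite (ger0_norm E1); lra.
have := sqr_ge0 x; have := sqr_ge0 y; lra.
Qed.

End Cexp.

(** * Convergence of Euler's limit, nonvanishing and functional equation of Gamma *)

Section GammaLimit.
Context (R : realType).
Implicit Type z : R[i].

(** Both bounds are ln (1 + x) <= x, at x = -1/(n+1) and at x = 1/n. *)
Lemma ln_succ_bounds n : (0 < n)%N ->
  n.+1%:R^-1 <= ln n.+1%:R - ln (n%:R : R) <= n%:R^-1.
Proof.
move=> n0; have n0R : 0 < n%:R :> R by rewrite ltr0n.
rewrite -ln_div ?posrE ?ltr0n //; apply/andP; split.
  rewrite -lerN2 -lnV ?posrE ?divr_gt0 ?ltr0n // invf_div.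
  have -> : n%:R / n.+1%:R = 1 + - n.+1%:R^-1 :> R.
    by rewrite -[in LHS](addrK 1 n%:R) natr1 mulrBl divff ?pnatr_eq0 // mul1r.
  by apply: le_ln1Dx; rewrite ltrN2 invf_lt1 ?ltr0n // ltr1n.
rewrite -natr1 mulrDl divff ?gt_eqF // mul1r.
by apply: le_ln1Dx; rewrite (lt_trans (ltrN10 R)) // invr_gt0.
Qed.

Lemma Gamma_seqS z n : (0 < n)%N ->
  Gamma_seq z n.+1 = Gamma_seq z n *
    (n.+1%:R / (z + n.+1%:R) * cexp (z * (ln n.+1%:R - ln n%:R)%:C)).
Proof.
move=> n0; rewrite /Gamma_seq [in LHS]big_nat_recr //= factS natrM.
have -> : z * (ln n.+1%:R)%:C =
    z * (ln n%:R)%:C + z * (ln n.+1%:R - ln n%:R)%:C.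
  by rewrite -mulrDr -rmorphD addrCA subrr addr0.
by rewrite cexpD invfM; ring.
Qed.

Lemma Gamma_seq_neq0 z n : (forall n : nat, z <> - n%:R) -> Gamma_seq z n != 0.
Proof.
move=> zN; rewrite mulf_neq0 //; last first.
  rewrite invr_eq0 prodf_seq_neq0; apply/allP => j _ /=.
  by rewrite addr_eq0; apply/eqP/zN.
by rewrite mulf_neq0 ?cexp_neq0 // pnatr_eq0 -lt0n fact_gt0.
Qed.

(** The ratio of consecutive terms is (n+1) exp u / (z+n+1) with u = z (ln (n+1) - ln n). Its
    first-order terms cancel: the numerator of ratio - 1 is O(1/n), the denominator at least n/2 in
    modulus. *)
Lemma Gamma_seq_ratio z :
  exists C N, 0 <= C /\ summable_ratio (Gamma_seq z) C N.
Proof.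
set c := normc z; have c0 : 0 <= c := normc_ge0 z.
(* The numerator is at most (8c^2 + c)/n; the denominator contributes a factor 2, and (n+1)(n+2) <=
   6n^2 the remaining 6. The threshold ensures n > 0 and 2c <= n, hence |u| <= 1/2. *)
exists (12 * (8 * c ^+ 2 + c)), (Num.bound (2 * c)).+1; split.
  by rewrite mulr_ge0 // addr_ge0 // mulr_ge0 // sqr_ge0.
move=> n Nn; have n0 : (0 < n)%N by exact: leq_trans Nn.
have n0R : 0 < n%:R :> R by rewrite ltr0n.
have cn : 2 * c <= n%:R.
  apply/ltW/(lt_le_trans (archi_boundP _)); first exact: mulr_ge0.
  by rewrite ler_nat ltnW.
rewrite Gamma_seqS // -[X in _ - X]mulr1 -mulrBr normcM ler_wpM2l ?normc_ge0 //.
have /andP[w1 w2] := ln_succ_bounds n0; set w := ln _ - ln _ in w1 w2 *.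
have w0 : 0 <= w by apply: le_trans w1.
have zn : n%:R / 2 <= normc (z + n.+1%:R).
  have := normcD (z + n.+1%:R) (- z).
  rewrite addrAC subrr add0r normc_nat normcN1.
  by rewrite -natr1 -/c; lra.
have zn0 : z + n.+1%:R != 0.
  apply: contraTneq zn => ->; rewrite normc0 -ltNge; lra.
set u := z * w%:C.
have uw : normc u = c * w by rewrite normcM normc_real ger0_norm.
have uc : normc u <= c / n%:R by rewrite uw ler_wpM2l.
have u2 : normc u <= 1 / 2.
  by apply: le_trans uc _; rewrite ler_pdivrMr //; lra.
have -> : n.+1%:R / (z + n.+1%:R) * cexp u - 1 =
    (n.+1%:R * (cexp u - 1 - u) + z * (n.+1%:R * w - 1)%:C) / (z + n.+1%:R).
  rewrite [(n.+1%:R * w - 1)%:C]rmorphB rmorphM rmorph_nat rmorph1 /u.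
  by field; rewrite -(natrD _ 1).
have n1 : n.+1%:R <= 2 * n%:R :> R.
  by rewrite -natrM ler_nat mul2n -addnn -addn1 leq_add2l.
have n2 : n.+2%:R <= 3 * n%:R :> R.
  by rewrite -natrM ler_nat mulSn mul2n -addnn -addn2 leq_add2l (@leq_add 1 1).
have w_le : `|n.+1%:R * w - 1| <= n%:R^-1.
  have w1' : 1 <= n.+1%:R * w by rewrite mulrC -ler_pdivrMr ?ltr0n // mul1r.
  rewrite ger0_norm ?subr_ge0 // lerBlDr.
  apply: le_trans (_ : n.+1%:R * n%:R^-1 <= _); first by rewrite ler_wpM2l.
  by rewrite -natr1 mulrDl mul1r divff ?gt_eqF // addrC.
set num := _ + z * _.
have num_le : normc num <= (8 * c ^+ 2 + c) / n%:R.
  apply: le_trans (normcD _ _) _; rewrite mulrDl lerD // normcM.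
    rewrite normc_nat.
    apply: le_trans (_ : 2 * n%:R * (4 * (c / n%:R) ^+ 2) <= _).
      rewrite ler_pM ?normc_ge0 //; apply: le_trans (cexp_sub_le u2) _.
      by rewrite ler_wpM2l // ler_pXn2r ?nnegrE ?normc_ge0 ?divr_ge0.
    rewrite le_eqVlt; apply/orP; left; apply/eqP; field; exact: lt0r_neq0.
  by rewrite normc_real ler_wpM2l.
have K0 : 0 <= 8 * c ^+ 2 + c by rewrite addr_ge0 // mulr_ge0 // sqr_ge0.
rewrite normcM normcV.
apply: le_trans (_ : (8 * c ^+ 2 + c) / n%:R * (n%:R / 2)^-1 <= _).
  rewrite ler_pM ?normc_ge0 ?invr_ge0 ?normc_ge0 //.
  rewrite lef_pV2 ?posrE ?normc_gt0 //.
  by rewrite divr_gt0.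
rewrite -mulrA -invfM [12 * _]mulrC -mulrA ler_wpM2l //.
rewrite -[12]invrK -invfM lef_pV2 ?posrE ?mulr_gt0 ?divr_gt0 ?invr_gt0 //.
apply: le_trans (_ : 12^-1 * ((2 * n%:R) * (3 * n%:R)) <= _).
  by rewrite ler_wpM2l ?ler_pM.
lra.
Qed.

(** [Gamma] is defined through [limn], which is known to be a limit only after convergence has been
    proved. *)
Lemma Gamma_seq_cvg z : (forall n : nat, z <> - n%:R) ->
  Gamma z != 0 /\ tends_to (Gamma_seq z) (Gamma z).
Proof.
move=> zN; have [C [N [C0 ratio]]] := Gamma_seq_ratio z.
have [l l0 al] := ratio_cvg_neq0 C0 (fun n => Gamma_seq_neq0 n zN) ratio.
have -> : Gamma z = l by exact: tends_to_lim al.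
by split.
Qed.

Lemma Gamma_neq0 z : (forall n : nat, z <> - n%:R) -> Gamma z != 0.
Proof. by move=> /Gamma_seq_cvg[]. Qed.

(** Passing to z + 1 removes the factor z from the denominator and adds z + n + 1, while n^(z+1) = n
    n^z. *)
Lemma Gamma_seq_add1 z n : (0 < n)%N -> (forall n : nat, z <> - n%:R) ->
  Gamma_seq (z + 1) n = z * Gamma_seq z n * (n%:R / (z + n.+1%:R)).
Proof.
move=> n0 zN; have zj j : z + j%:R != 0 by rewrite addr_eq0; apply/eqP/zN.
have prodE : \prod_(0 <= j < n.+1) (z + 1 + j%:R) =
    z^-1 * \prod_(0 <= j < n.+1) (z + j%:R) * (z + n.+1%:R).
  rewrite -mulrA -(big_nat_recr n.+1) //= [in RHS]big_nat_recl // addr0.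
  rewrite mulKf; last by have := zj 0; rewrite addr0.
  apply: eq_bigr => j _.
  by rewrite -natr1 -addrA [1 + _]addrC.
rewrite /Gamma_seq prodE mulrDl mul1r cexpD cexp_ln // !invfM invrK; ring.
Qed.

Lemma cvg_invDn z :
  tends_to (fun n => (z + n.+1%:R)^-1) 0.
Proof.
apply/tends_toP => e e0.
have eE : e = (complex.Re e)%:C by rewrite RRe_real // gtr0_real.
rewrite eE ltcR in e0.
exists (Num.bound (normc z + (complex.Re e)^-1)) => // n /= nb.
have {nb} nb : normc z + (complex.Re e)^-1 <= n%:R.
  apply/ltW/(lt_le_trans (archi_boundP _)); last by rewrite ler_nat.
  by rewrite addr_ge0 ?normc_ge0 // invr_ge0 ltW.
have ez : (complex.Re e)^-1 <= normc (z + n.+1%:R).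
  have := normcD (z + n.+1%:R) (- z).
  rewrite addrAC subrr add0r normc_nat normcN1.
  by rewrite -natr1; lra.
rewrite eE normr_normc lecR sub0r normcN1 normcV.
rewrite -[leRHS]invrK lef_pV2 // posrE ?invr_gt0 //.
by apply: lt_le_trans ez; rewrite invr_gt0.
Qed.

Lemma Gamma_add1 z :
  (forall n : nat, z <> - n%:R) -> Gamma (z + 1) = z * Gamma z.
Proof.
move=> zN; apply: tends_to_lim; have [_ zG] := Gamma_seq_cvg zN.
(* n/(z+n+1) is written as 1 - (z+1)/(z+n+1), which tends to 1. *)
have n_cvg := tends_toB (@tends_to_cst R[i] 1)
  (tends_toM (@tends_to_cst R[i] (z + 1)) (cvg_invDn z)).
have := tends_toM (tends_toM (@tends_to_cst R[i] z) zG) n_cvg.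
rewrite mulr0 subr0 mulr1; apply: near_eq_tends_to; exists 1%N => // n /= n0.
rewrite Gamma_seq_add1 //; congr (_ * _).
have zn0 : z + n.+1%:R != 0 by rewrite addr_eq0; apply/eqP/zN.
by field; rewrite -(natrD _ 1).
Qed.

End GammaLimit.

(** * Operators in the basis |l,k> *)

Section Freeg.
Context (R : nzRingType) (K : choiceType) (M : lmodType R) (f : K -> M).

HB.instance Definition _ :=
  GRing.isAdditive.Build {freeg K / R} M (fglift f) (@lift_is_additive R K M f).

Lemma fgliftE (D : {freeg K / R}) :
  fglift f D = \sum_(z <- dom D) coeff z D *: f z.
Proof.
rewrite -[in LHS](freeg_sumE D) raddf_sum /=.
by apply: eq_bigr => z _; rewrite liftU.
Qed.

Lemma fglift_is_scalable : scalable (fglift f).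
Proof.
move=> a D; rewrite [in RHS]fgliftE scaler_sumr.
(* Scaling in the free module is this sum by definition. *)
have -> : a *: D = \sum_(x <- dom D) << a * coeff x D *g x >> by [].
rewrite raddf_sum /=.
by apply: eq_bigr => z _; rewrite liftU scalerA.
Qed.

HB.instance Definition _ :=
  GRing.isScalable.Build R {freeg K / R} M *:%R (fglift f) fglift_is_scalable.

Lemma fglift1 z : fglift f << z >> = f z.
Proof. by rewrite liftU scale1r. Qed.

(** Uniqueness in the universal property of the free module. *)
Lemma fglift_ext (g : {linear {freeg K / R} -> M}) :
  (forall z, g << z >> = f z) -> g =1 fglift f.
Proof.
move=> gf D; rewrite -{1}(freeg_sumE D) raddf_sum fgliftE /=.
apply: eq_bigr => z _; rewrite -gf -linearZ; congr (g _).
apply/eqP/freeg_eqP => y.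
by rewrite coeffZ !coeffU mul1r.
Qed.

End Freeg.

HB.instance Definition _ (R : realType) (lam : R[i]) :=
  GRing.Linear.on (@opH R lam).
HB.instance Definition _ (R : realType) (lam : R[i]) :=
  GRing.Linear.on (@opE R lam).
HB.instance Definition _ (R : realType) (lam : R[i]) :=
  GRing.Linear.on (@opF R lam).

Section Operators.
Context (R : realType) (lam1 lam2 : R[i]).
Implicit Types (lam : R[i]) (p q : Kset lam1 * Kset lam2) (v w : VV lam1 lam2).

HB.instance Definition _ (A : V lam1 -> V lam1) (B : V lam2 -> V lam2) :=
  GRing.Linear.on (@tensop R lam1 lam2 A B).
HB.instance Definition _ (T : nat -> VV lam1 lam2 -> VV lam1 lam2) :=
  GRing.Linear.on (@opsum R lam1 lam2 T).
HB.instance Definition _ (g : nat -> nat -> R[i]) :=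
  GRing.Linear.on (@diagop R lam1 lam2 g).
HB.instance Definition _ (A : VV lam1 lam2 -> VV lam1 lam2) :=
  GRing.Linear.on (@diaginv R lam1 lam2 A).
HB.instance Definition _ := GRing.Linear.on (@flip R lam1 lam2).
HB.instance Definition _ (eta del1 del2 : R[i]) :=
  GRing.Linear.on (@Qinv R eta lam1 lam2 del1 del2).
HB.instance Definition _ (eta del1 del2 : R[i]) :=
  GRing.Linear.on (@Rplus R eta lam1 lam2 del1 del2).

Lemma eq_on_kets (f g : {linear VV lam1 lam2 -> VV lam1 lam2}) :
  (forall p, f (ket2 p) = g (ket2 p)) -> f =1 g.
Proof.
move=> fg v; rewrite (fglift_ext (f := fun p => g (ket2 p))) //.
by apply: esym; apply: fglift_ext.
Qed.

Lemma ket_val lam (i : Kset lam) : ket lam (val i) = << i >>.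
Proof. by rewrite /ket valK. Qed.

Lemma opH_basis lam (i : Kset lam) :
  opH (<< i >> : V lam) = (lam - (val i)%:R) *: (<< i >> : V lam).
Proof. by rewrite /opH fglift1 ket_val. Qed.

Lemma tensvZl a (v : V lam1) (w : V lam2) : tensv (a *: v) w = a *: tensv v w.
Proof. by rewrite /tensv linearZ. Qed.

Lemma tensv0l (w : V lam2) : tensv (0 : V lam1) w = 0.
Proof. by rewrite /tensv linear0. Qed.

(** The nested lifts show linearity in the first factor only; this symmetric double sum gives
    compatibility with [flip], and thereby linearity in the second. *)
Lemma tensvE (v : V lam1) (w : V lam2) :
  tensv v w = \sum_(i <- dom v) \sum_(j <- dom w)
    (coeff i v * coeff j w) *: ket2 (i, j).
Proof.
rewrite /tensv fgliftE; apply: eq_bigr => i _.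
rewrite fgliftE scaler_sumr; apply: eq_bigr => j _.
by rewrite scalerA.
Qed.

Lemma tensv_basis (i : Kset lam1) (j : Kset lam2) :
  tensv << i >> << j >> = ket2 (i, j).
Proof. by rewrite /tensv !fglift1. Qed.

Lemma tensop_ket2 A B p :
  tensop A B (ket2 p) = tensv (A << p.1 >>) (B << p.2 >>).
Proof. by rewrite /tensop fglift1. Qed.

Lemma diagop_ket2 g p : diagop g (ket2 p) = g (val p.1) (val p.2) *: ket2 p.
Proof. by rewrite /diagop fglift1. Qed.

Lemma diaginv_ket2 (A : VV lam1 lam2 -> VV lam1 lam2) c p :
  A (ket2 p) = c *: ket2 p -> diaginv A (ket2 p) = c^-1 *: ket2 p.
Proof.
by move=> Ap; rewrite /diaginv fglift1 Ap coeffZ coeffU eqxx !mulr1.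
Qed.

Lemma opsum_ket2 T N p : (forall n, (N <= n)%N -> T n (ket2 p) = 0) ->
  opsum T (ket2 p) = \sum_(n < N) T n (ket2 p).
Proof.
move=> TN; rewrite /opsum fglift1 -(fsbig_widen `I_N) //.
  by rewrite -fsbig_ord.
by move=> n [_ /negP]; rewrite -leqNgt => /TN.
Qed.

Lemma flip_ket2 p : flip (ket2 p) = ket2 (p.2, p.1).
Proof. by rewrite /flip fglift1. Qed.

End Operators.

Section Flip.
Context (R : realType) (lam1 lam2 : R[i]).
Implicit Types (lam : R[i]) (p q : Kset lam1 * Kset lam2) (v w : VV lam1 lam2).

Lemma flip_tensv (v : V lam1) (w : V lam2) : flip (tensv v w) = tensv w v.
Proof.
rewrite !tensvE exchange_big raddf_sum; apply: eq_bigr => j _.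
rewrite raddf_sum; apply: eq_bigr => i _.
by rewrite /= linearZ /= flip_ket2 /= mulrC.
Qed.

End Flip.

Section KetBasis.
Context (R : realType) (lam1 lam2 : R[i]).

HB.instance Definition _ (eta del1 del2 : R[i]) :=
  GRing.Linear.on (@Q R eta lam1 lam2 del1 del2).
HB.instance Definition _ (eta del1 del2 : R[i]) :=
  GRing.Linear.copy (@R0_chi R eta lam1 lam2 del1 del2)
    ((chi eta lam1 lam2 del1 del2)^-1 \*: diagop (rho eta lam1 lam2 del1 del2)).
HB.instance Definition _ (eta del1 del2 : R[i]) :=
  GRing.Linear.copy (@Qinv21 R eta lam1 lam2 del1 del2)
    (@flip R lam2 lam1 \o @Qinv R eta lam2 lam1 del2 del1 \o @flip R lam1 lam2).

Implicit Types (lam : R[i]) (p q : Kset lam1 * Kset lam2) (v w : VV lam1 lam2).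

Lemma tensvZr a (v : V lam1) (w : V lam2) : tensv v (a *: w) = a *: tensv v w.
Proof. by rewrite -flip_tensv tensvZl linearZ /= flip_tensv. Qed.

Lemma tensv0r (v : V lam1) : tensv v (0 : V lam2) = 0.
Proof. by rewrite -flip_tensv tensv0l linear0. Qed.

(** E lowers k by one and kills |0>. This makes the sums defining the twist and the R-matrix factors
    finite on each basis vector. *)
Lemma iter_opE_ket lam n k : (k < n)%N -> iter n (@opE R lam) (ket lam k) = 0.
Proof.
have iterZ m a (v : V lam) :
    iter m (@opE R lam) (a *: v) = a *: iter m (@opE R lam) v.
  by elim: m => //= m ->; rewrite linearZ.
elim: n k => // n IHn k kn; rewrite iterSr.
rewrite [ket lam k]/ket; case: insubP => [i _ ik|_].
  rewrite /opE fglift1 ik iterZ; case: k kn {ik} => [|k] kn.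
    by rewrite scale0r.
  by rewrite IHn ?scaler0.
(* Outside of [Kset] the ket is 0 by convention. *)
rewrite linear0; elim: n {IHn kn} => //= n ->; exact: linear0.
Qed.

Lemma shiftH_ket2 eta del1 del2 c p :
  shiftH eta del1 del2 c (ket2 p) =
  (del1 - del2 + eta * ((lam1 - (val p.1)%:R) - (lam2 - (val p.2)%:R)) + c)
    *: ket2 p.
Proof.
case: p => i j; rewrite /shiftH !tensop_ket2 /= !opH_basis tensvZl tensvZr.
by rewrite !tensv_basis -scalerBl scalerA -!scalerDl.
Qed.

Lemma invprod_ket2 eta del1 del2 s n p :
  invprod eta del1 del2 s n (ket2 p) =
  (\prod_(1 <= j < n.+1)
    (del1 - del2 + eta * ((lam1 - (val p.1)%:R) - (lam2 - (val p.2)%:R))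
      + s * j%:R)^-1) *: ket2 p.
Proof.
rewrite /invprod; elim: (index_iota 1 n.+1) => [|j r IHr].
  by rewrite !big_nil scale1r.
rewrite !big_cons /= IHr linearZ /= (diaginv_ket2 (shiftH_ket2 _ _ _ _ _)).
by rewrite scalerA mulrC.
Qed.

End KetBasis.

(** * The inverse twist with exchanged factors *)

Section Twist.
Context (R : realType) (eta lam1 lam2 : R[i]).
Implicit Type (p : Kset lam1 * Kset lam2).

Lemma Finv21E del1 del2 :
  @Finv21 R eta lam1 lam2 del1 del2 =
  @Rplus R eta lam1 lam2 del1 del2 \o @Qinv21 R eta lam1 lam2 del1 del2.
Proof.
apply/funext; apply: eq_on_kets => p.
rewrite /= /Finv21 /Qinv21 /swap21 /Finv /= flip_ket2 /= /Qinv.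
rewrite !diagop_ket2 !linearZ /= flip_ket2 -surjective_pairing /=.
(* In both sums E^n acts on V_lam1 and kills |l> for n > l, so l + 1 terms suffice. *)
congr (_ *: _); rewrite /Rplus !(@opsum_ket2 _ _ _ _ (val p.1).+1).
- rewrite raddf_sum; apply: eq_bigr => n _ /=.
  rewrite !invprod_ket2 !linearZ /= !tensop_ket2 /= flip_tensv !scalerA.
  congr (_ *: _).
  set x := \prod_(_ <= _ < _) _; set y := \prod_(_ <= _ < _) _.
  suff -> : x = (-1) ^+ n * y.
    have sgn1 : (-1) ^+ n * (-1) ^+ n = 1 :> R[i].
      by rewrite -exprMn mulrNN mulr1 expr1n.
    by rewrite (exprNn eta) -[RHS]mul1r -[X in _ = X * _]sgn1; ring.
  have -> : (-1) ^+ n = \prod_(1 <= j < n.+1) (-1 : R[i]).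
    by rewrite prodr_const_nat subSS subn0.
  rewrite -big_split /=; apply: eq_bigr => j _.
  (* As -1 is its own inverse, the sign moves inside the inverse, also where the factor vanishes. *)
  by rewrite -[-1]invrN1 -invfM; congr (_^-1); ring.
- move=> n pn; rewrite invprod_ket2 linearZ /= tensop_ket2 -ket_val.
  by rewrite iter_opE_ket // tensv0l !scaler0.
- move=> n pn; rewrite invprod_ket2 linearZ /= tensop_ket2 /=.
  by rewrite -(ket_val p.1) iter_opE_ket // tensv0r !scaler0.
Qed.

End Twist.

(** * Eigenvalues of R_0 *)

Section Diagonal.
Context (R : realType).
Implicit Type x z : R[i].

(** Invariant under integer shifts, so one hypothesis keeps a whole family of shifted half arguments
    off the poles of Gamma. *)
Definition nonint x := forall m : int, x <> m%:~R.

Lemma nonintDn x n : nonint x -> nonint (x + n%:R).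
Proof. by move=> xN m xm; apply: (xN (m - n%:Z)); rewrite intrB -xm addrK. Qed.

Lemma nonintBn x n : nonint x -> nonint (x - n%:R).
Proof. by move=> xN m xm; apply: (xN (m + n%:Z)); rewrite intrD -xm subrK. Qed.

Lemma nonint_half x : nonint x -> forall n : nat, x / 2 <> - n%:R.
Proof.
move=> xN n xn; apply: (xN (- (n * 2)%N%:Z)).
by rewrite mulrNz -pmulrn natrM -mulNr -xn divfK ?pnatr_eq0.
Qed.

Lemma Gamma_half_neq0 x : nonint x -> Gamma (x / 2) != 0.
Proof. by move=> /nonint_half/Gamma_neq0. Qed.

(* By the duplication formula this is a multiple of Gamma x / 2 ^ x. *)
Definition Gamma2 x := Gamma (x / 2) * Gamma ((x + 1) / 2).

Lemma Gamma2D x n : nonint x ->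
  Gamma2 (x + n%:R) = (\prod_(0 <= j < n) ((x + j%:R) / 2)) * Gamma2 x.
Proof.
move=> xN; elim: n => [|n IHn]; first by rewrite addr0 big_nil mul1r.
rewrite big_nat_recr //= mulrAC -IHn -natr1 addrA /Gamma2.
(* The shift by 1 exchanges the two Gamma factors and raises the argument of one of them by 1. *)
have -> : (x + n%:R + 1 + 1) / 2 = (x + n%:R) / 2 + 1 by field.
rewrite Gamma_add1; first by ring.
exact/nonint_half/nonintDn.
Qed.

(** Trades the common factor eta or -eta of the [qcoef] fractions for the 1/2 of [Gamma2D]. *)
Lemma mulf_div_half (c u v : R[i]) :
  c != 0 -> c * u / (c * v) = (u / 2) / (v / 2).
Proof.
by move=> c0; rewrite -!mulf_div !divff ?mul1r ?mulr1 ?invr_eq0 ?pnatr_eq0.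
Qed.

(** With a = d+lam1-lam2, b = d+lam1+lam2, c = d-lam1-lam2 and G = [Gamma2], the left side is
    G(a+k+1)/G(a+k-l+1) * G(b-l+1)/G(b+1) * G(c+k)/G(c) * G(a-l)/G(a+k-l). Each quotient is one of
    the four products in the two [qcoef], or its inverse. *)
Lemma rho_div_chi (eta lam1 lam2 del1 del2 : R[i]) (l k : nat) : eta <> 0 ->
  let d := (del1 - del2) / eta in
  nonint (d + lam1 - lam2) -> nonint (d + lam1 + lam2) ->
  nonint (d - lam1 - lam2) -> nonint (d - lam1 + lam2) ->
  (chi eta lam1 lam2 del1 del2)^-1 * rho eta lam1 lam2 del1 del2 l k =
  qcoef eta lam2 lam1 del2 del1 k l * (qcoef eta lam1 lam2 del1 del2 l k)^-1.
Proof.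
move=> /eqP eta0 d aN bN cN eN.
have -> : qcoef eta lam2 lam1 del2 del1 k l =
  \prod_(0 <= j < l) ((d + lam1 - lam2 + k%:R - l%:R + 1 + j%:R) / 2) /
  \prod_(0 <= j < l) ((d + lam1 + lam2 - l%:R + 1 + j%:R) / 2).
  (* The exchanged factors are -eta times quantities decreasing in j; reversing j gives the
     increasing products of [Gamma2D]. *)
  rewrite /qcoef big_nat_rev -prodf_div big_nat [RHS]big_nat.
  apply: eq_bigr => j.
  rewrite add0n => jl.
  have -> : (l - j.+1)%:R = l%:R - 1 - j%:R :> R[i].
    by rewrite natrB // -addn1 natrD opprD addrA addrAC.
  rewrite -(@mulf_div_half (- eta)) ?oppr_eq0 // /d.
  by congr (_ / _); field.
have -> : qcoef eta lam1 lam2 del1 del2 l k =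
  \prod_(0 <= j < k) ((d + lam1 - lam2 - l%:R + j%:R) / 2) /
  \prod_(0 <= j < k) ((d - lam1 - lam2 + j%:R) / 2).
  rewrite /qcoef -prodf_div; apply: eq_bigr => j _.
  by rewrite -(mulf_div_half _ _ eta0) /d; congr (_ / _); field.
have akN := nonintDn (n := k) aN; have alN := nonintBn (n := l) aN.
have aklN := nonintBn (n := l) akN; have akl1N := @nonintDn _ 1 aklN.
have ckN := nonintDn (n := k) cN.
have blN := @nonintDn _ 1 (nonintBn (n := l) bN).
have := Gamma2D l akl1N; have := Gamma2D k alN; have := Gamma2D k cN.
have := Gamma2D l blN.
set P1 := \prod_(_ <= _ < _) _; set P2 := \prod_(_ <= _ < _) _.
set P3 := \prod_(_ <= _ < _) _; set P4 := \prod_(_ <= _ < _) _.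
move: P1 P2 P3 P4 => P1 P2 P3 P4.
have addl1 x : x - l%:R + 1 + l%:R = x + 1 :> R[i] by ring.
have addlk x : x - l%:R + k%:R = x + k%:R - l%:R :> R[i] by ring.
rewrite !addl1 addlk /Gamma2.
have add2 x : x + 1 + 1 = x + 2 :> R[i] by ring.
rewrite !add2.
have nz x n : nonint x -> Gamma ((x + n%:R) / 2) != 0.
  by move=> xN; apply/Gamma_half_neq0/nonintDn.
have nz0 x : nonint x -> Gamma (x / 2) != 0 by exact: Gamma_half_neq0.
have := nz _ 1%N aN; have := nz _ 1%N eN.
have := nz _ 1%N bN; have := nz _ 2%N bN.
have := nz _ 1%N cN; have := nz0 _ cN; have := nz0 _ aklN.
have := nz _ 1%N aklN; have := nz _ 2%N aklN.
have := nz0 _ alN; have := nz _ 1%N alN; have := nz0 _ blN.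
have := nz _ 1%N blN; have := nz0 _ ckN; have := nz _ 1%N ckN.
rewrite /chi /rho -/d.
rewrite -!add2; do ![move: (Gamma _) => ?].
do 15![move=> ?] => E1 E2 E3 E4.
(* Each product is replaced by its quotient of Gamma values, which are by now nonzero field
   variables. *)
rewrite -(canLR (mulfK _) E1) -?(canLR (mulfK _) E2) -?(canLR (mulfK _) E3);
  rewrite -?(canLR (mulfK _) E4); try by rewrite mulf_neq0.
by field; do ?[apply/andP; split].
Qed.

End Diagonal.

(** * Local finiteness of the exceptional parameters *)

Section Exceptional.
Context (R : realType).
Implicit Type c z : R[i].

Lemma finite_int_lt N : finite_set [set m : int | (`|m| < N)%N].
Proof.
apply: (@sub_finite_set _ _ ((Posz @` `I_N) `|` ((fun n => - Posz n) @` `I_N))).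
  move=> m mN; have [m0|m0] := leP 0 m.
    by left; exists `|m|%N => //; rewrite gez0_abs.
  by right; exists `|m|%N => //; rewrite ltz0_abs ?opprK.
by rewrite finite_setU; split; apply: finite_image; apply: finite_II.
Qed.

Lemma locally_finiteU (A B : set R[i]) :
  locally_finite A -> locally_finite B -> locally_finite (A `|` B).
Proof. by move=> Af Bf r; rewrite setIUl finite_setU. Qed.

(** |z| <= r forces |m| <= r/|eta| + |c|, and z = eta (m - c) is determined by m. *)
Lemma locally_finite_progression (eta c : R[i]) : eta != 0 ->
  locally_finite [set z | exists m : int, z / eta + c = m%:~R].
Proof.
move=> eta0 r; pose X := r%:C / `|eta| + `|c|.
pose N := Num.bound (complex.Re X).
apply: (@sub_finite_set _ _ ((fun m : int => eta * (m%:~R - c)) @`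
    [set m : int | (`|m| < N)%N])); last exact/finite_image/finite_int_lt.
move=> z [[m zm] zr]; exists m; last by rewrite -zm addrK mulrC divfK.
have mX : `|m%:~R : R[i]| <= X.
  rewrite -zm (le_trans (ler_normD _ _)) // lerD2r normrM normfV.
  by rewrite ler_pM2r // invr_gt0 normr_gt0.
have mE : `|m%:~R : R[i]| = (`|m|%:R : R)%:C.
  by rewrite -intr_norm -abszE -pmulrn rmorph_nat.
have X0 : 0 <= X by apply: le_trans mX.
have XE : X = (complex.Re X)%:C by rewrite RRe_real ?ger0_real.
move: mX; rewrite mE XE lecR => mX /=; rewrite -(ltr_nat R).
by apply: le_lt_trans mX _; apply: archi_boundP; rewrite -lecR -XE.
Qed.

End Exceptional.

(** * Factorization of the normalized R-matrix by the twist *)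

Theorem mainTheorem1 (R : realType) (eta lam1 lam2 : R[i]) (eta_neq0 : eta <> 0) :
  let F12 := @F R eta lam1 lam2 in
  let F21inv := @Finv21 R eta lam1 lam2 in
  let Q12 := @Q R eta lam1 lam2 in
  let Q21inv := @Qinv21 R eta lam1 lam2 in
  let Rp := @Rplus R eta lam1 lam2 in
  let Rm := @Rminus R eta lam1 lam2 in
  let R0chi := @R0_chi R eta lam1 lam2 in
  [/\ op_eq R0chi (fun d1 d2 => Q21inv d1 d2 \o Q12 d1 d2),
      op_eq F21inv (fun d1 d2 => Rp d1 d2 \o Q21inv d1 d2),
      op_eq F12 (fun d1 d2 => Q12 d1 d2 \o Rm d1 d2),
      op_eq (fun d1 d2 => F21inv d1 d2 \o F12 d1 d2)
            (fun d1 d2 => Rp d1 d2 \o Q21inv d1 d2 \o Q12 d1 d2 \o Rm d1 d2) &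
      op_eq (fun d1 d2 => Rp d1 d2 \o Q21inv d1 d2 \o Q12 d1 d2 \o Rm d1 d2)
            (fun d1 d2 => Rp d1 d2 \o R0chi d1 d2 \o Rm d1 d2)].
Proof.
have lf0 : locally_finite (set0 : set R[i]).
  by move=> r; rewrite set0I; exact: finite_set0.
pose P c : set R[i] := [set z | exists m : int, z / eta + c = m%:~R].
(* The values of del1 - del2 for which one of d +- lam1 +- lam2 is an integer. *)
pose S := P (lam1 - lam2) `|` P (lam1 + lam2) `|` P (- lam1 - lam2)
  `|` P (- lam1 + lam2).
have lfS : locally_finite S.
  by do ![apply: locally_finiteU]; apply/locally_finite_progression/eqP.
have R0E del1 del2 : ~ S (del1 - del2) ->
    @R0_chi R eta lam1 lam2 del1 del2 =
    @Qinv21 R eta lam1 lam2 del1 del2 \o @Q R eta lam1 lam2 del1 del2.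
  move=> /not_orP[/not_orP[/not_orP[N1 N2] N3] N4].
  have notP c : ~ P c (del1 - del2) -> nonint ((del1 - del2) / eta + c).
    by move=> NP m E; apply: NP; exists m.
  apply/funext; apply: eq_on_kets => p.
  rewrite /= /R0_chi /R0 diagop_ket2 scalerA rho_div_chi //; last first.
  - by rewrite -addrA; exact: notP.
  - by rewrite -addrA; exact: notP.
  - by rewrite -addrA; exact: notP.
  - by rewrite -addrA; exact: notP.
  rewrite /= /Q (diaginv_ket2 (diagop_ket2 _ _)).
  rewrite /Qinv21 /swap21 /= !linearZ /= flip_ket2 /Qinv diagop_ket2.
  rewrite !linearZ /=.
  by rewrite flip_ket2 /= scalerA mulrC -surjective_pairing.
(* Only the two identities involving R_0 need the exceptional set [S]; the other three hold at all
   parameters. *)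
split=> p q.
- by exists S => // del1 del2 /R0E ->.
- by exists set0 => // del1 del2 _; rewrite Finv21E.
- by exists set0.
- by exists set0 => // del1 del2 _; rewrite Finv21E.
- by exists S => // del1 del2 /R0E ->.
Qed.
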